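(* Let $\{f(y\mid\theta):\theta\in\Omega\}$ be a family of densities with respect to a measure $\mu$, let $Y_1,\dots,Y_n$ be observations, and let $\hat G$ be a GMLE based on $Y_1,\dots,Y_n$. Let $\eta:\Omega\to\mathbb R$ be a bounded (measurable) function. Then $$\hat\eta_G:= E_{\hat G}\,\eta(\theta)=\frac1n\sum_{i=1}^n E_{\hat G}\bigl(\eta(\theta)\mid Y_i\bigr).$$
   Context: For a probability distribution $G$ on $\Omega$, $f_G(y)=\int f(y\mid\vartheta)\,dG(\vartheta)$ and $E_G\,\eta(\theta)=\int\eta\,dG$. GMLE (generalized maximum likelihood estimator): any probability distribution $\hat G$ on $\Omega$ that maximizes $\prod_{i=1}^n f_G(Y_i)$ over all probability distributions $G$ on $\Omega$; the maximal value is understood to be positive and finite. $E_{\hat G}(\eta(\theta)\mid Y_i)$ is the conditional expectation of $\eta(\theta)$ given $Y=Y_i$ when $\theta\sim\hat G$ and $Y\mid\theta\sim f(\cdot\mid\theta)$, i.e. $$E_{\hat G}(\eta(\theta)\mid Y_i)=\frac{\int\eta(\theta)f(Y_i\mid\theta)\,d\hat G(\theta)}{\int f(Y_i\mid\theta)\,d\hat G(\theta)} .$$ *)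

(* Defs.v *)
From HB Require Import structures.
From mathcomp Require Import all_boot all_order all_algebra.
From mathcomp Require Import all_classical all_reals all_analysis.
Import Order.TTheory GRing.Theory Num.Theory.
Import numFieldNormedType.Exports.

Set Implicit Arguments.
Unset Strict Implicit.
Unset Printing Implicit Defensive.

Local Open Scope classical_set_scope.
Local Open Scope ring_scope.
Local Open Scope ereal_scope.

(** Throughout, [f y t] stands for the density f(y | t) at the observation [y]
    under the parameter [t]. *)

Definition density_family (R : realType) (dT : measure_display)
    (T : measurableType dT) (Omega : Type)
    (mu : {measure set T -> \bar R}) (f : T -> Omega -> R) : Prop :=
  forall t : Omega,
    [/\ measurable_fun setT (fun y => f y t),
        forall y, (0 <= f y t)%R
      & \int[mu]_y (f y t)%:E = 1].

(** [f_G(y)] may be [+oo], since [f y] need not be bounded in the parameter. *)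
Definition mixture_density (R : realType) (T : Type) (dO : measure_display)
    (Omega : measurableType dO) (f : T -> Omega -> R)
    (G : probability Omega R) (y : T) : \bar R :=
  \int[G]_t (f y t)%:E.

(** The product is taken in [\bar R], where [0 * +oo = 0]. *)
Definition likelihood (R : realType) (T : Type) (dO : measure_display)
    (Omega : measurableType dO) (f : T -> Omega -> R) (n : nat) (Y : 'I_n -> T)
    (G : probability Omega R) : \bar R :=
  \prod_(i < n) mixture_density f G (Y i).

Definition is_GMLE (R : realType) (T : Type) (dO : measure_display)
    (Omega : measurableType dO) (f : T -> Omega -> R) (n : nat) (Y : 'I_n -> T)
    (Ghat : probability Omega R) : Prop :=
  [/\ 0 < likelihood f Y Ghat,
      likelihood f Y Ghat < +oo
    & forall G : probability Omega R, likelihood f Y G <= likelihood f Y Ghat].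

(** [E_G(eta(theta) | Y = y)] for [theta ~ G] and [Y | theta ~ f(. | theta)],
    given by Bayes' formula.  It is meaningful when [f_G(y)] is positive and
    finite, which is the case at every observation if [G] is a GMLE. *)
Definition posterior_expectation (R : realType) (T : Type)
    (dO : measure_display) (Omega : measurableType dO) (f : T -> Omega -> R)
    (G : probability Omega R) (eta : Omega -> R) (y : T) : \bar R :=
  (\int[G]_t (eta t * f y t)%:E) / mixture_density f G y.

(* Main.v *)
(** Tilt the maximizer: for small [e] the measure with density
    [1 + e * (eta - E eta)] with respect to [Ghat] is again a probability, and
    the mixture density at [Y i] becomes affine in [e], with slope equal to the
    integral of [(eta - E eta) * f (Y i)].  The likelihood is then a polynomial
    in [e] that is maximal at [e = 0], so its logarithmic derivative there,
    [\sum_i (E (eta | Y i) - E eta)], vanishes. *)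

Require Import Defs.
From HB Require Import structures.
From mathcomp Require Import all_boot all_order all_algebra.
From mathcomp Require Import all_classical all_reals all_analysis measurable_realfun.
From mathcomp Require Import ring.
Import Order.TTheory GRing.Theory Num.Theory.
Import numFieldNormedType.Exports.

Set Implicit Arguments.
Unset Strict Implicit.
Unset Printing Implicit Defensive.

Local Open Scope classical_set_scope.
Local Open Scope ring_scope.
Local Open Scope ereal_scope.

Section tilted_probability.
Context {d : measure_display} {T : measurableType d} {R : realType}.
Variables (P : probability T R) (w : T -> R).
Hypotheses (w_ge0 : forall t, (0 <= w t)%R)
  (w_meas : measurable_fun setT w) (w_int1 : \int[P]_t (w t)%:E = 1).

(** The hypotheses on [w] are arguments so that the probability structure can
    be attached to the constant. *)
Definition tilt_of (_ : forall t, (0 <= w t)%R) (_ : measurable_fun setT w)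
    (_ : \int[P]_t (w t)%:E = 1) (A : set T) : \bar R :=
  \int[P]_(t in A) (w t)%:E.

Local Notation tilt := (tilt_of w_ge0 w_meas w_int1).

Let tilt0 : tilt set0 = 0.
Proof. exact: integral_set0. Qed.

Let tilt_ge0 A : 0 <= tilt A.
Proof. by apply: integral_ge0 => t _; rewrite lee_fin. Qed.

Let tilt_sigma_additive : semi_sigma_additive tilt.
Proof.
move=> F mF tF mUF; rewrite /tilt_of ge0_integral_bigcup//=.
- by apply: is_cvg_ereal_nneg_natsum_cond => n _ _; exact: tilt_ge0.
- by apply/measurable_EFinP; exact: measurable_funTS.
- by move=> t _; rewrite lee_fin.
Qed.

HB.instance Definition _ :=
  isMeasure.Build _ _ _ tilt tilt0 tilt_ge0 tilt_sigma_additive.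

Let tilt_setT : tilt setT = 1.
Proof. exact: w_int1. Qed.

HB.instance Definition _ := Measure_isProbability.Build _ _ _ tilt tilt_setT.

Import HBNNSimple.

(** Decompose [h] into indicators of its level sets: the [tilt] mass of a level set is by definition
    the [P]-integral of [w] over it. *)
Let sintegral_tilt (h : {nnsfun T >-> R}) :
  sintegral tilt h = \int[P]_t ((h t)%:E * (w t)%:E).
Proof.
transitivity (\int[P]_t \sum_(y \in range h)
    (y%:E * ((\1_(h @^-1` [set y]) t)%:E * (w t)%:E))); last first.
  apply: eq_integral => t _; rewrite -EFinM [in RHS]fimfunE mulr_fsuml.
  by rewrite -fsumEFin//; apply: eq_fsbigr => y _; rewrite -!EFinM mulrA.
have mind y : measurable_fun setT
    (fun t => (\1_(h @^-1` [set y]) t)%:E * (w t)%:E).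
  by apply: emeasurable_funM; apply/measurable_EFinP.
rewrite sintegralE ge0_integral_fsum//; last 2 first.
- by move=> y; exact: measurable_funeM.
- move=> y t _; rewrite -!EFinM lee_fin mulrA mulr_ge0//.
  by have /= := nnfun_muleindic_ge0 h y t; rewrite lee_fin.
(* Only values [y = h t] occur in the sum, so the coefficient is nonnegative and can be pulled out
   of the integral. *)
apply: eq_fsbigr => y /[!inE] -[t _ <-]; rewrite ge0_integralZl//; last 2 first.
- by move=> x _; rewrite -EFinM lee_fin mulr_ge0.
- by rewrite lee_fin.
rewrite /= /tilt_of integral_mkcond; congr (_ * _).
by apply: eq_integral => x _; rewrite epatch_indic muleC.
Qed.

(** Simple functions increasing to [g] reduce this to [sintegral_tilt], by monotone convergence
    under both [tilt] and [P]. It turns mixture densities of the tilted law into integrals against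
    the original one. *)
Lemma ge0_integral_tilt (g : T -> \bar R) :
    measurable_fun setT g -> (forall t, 0 <= g t) ->
  \int[tilt]_t g t = \int[P]_t (g t * (w t)%:E).
Proof.
move=> mg g0; pose h := nnsfun_approx measurableT mg.
have cvg_h t : (h n t)%:E @[n --> \oo] --> g t by exact: cvg_nnsfun_approx.
have nd_h t : {homo (fun n => (h n t)%:E) : m n / (m <= n)%N >-> m <= n}.
  by move=> m n mn; rewrite lee_fin; exact/lefP/nd_nnsfun_approx.
have -> : \int[tilt]_t g t = limn (fun n => \int[tilt]_t (h n t)%:E).
  rewrite -(@monotone_convergence _ _ _ tilt)//; last 2 first.
  - by move=> n; apply/measurable_EFinP.
  - by move=> n t _; rewrite lee_fin.
  by apply: eq_integral => t _; apply/esym/cvg_lim.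
transitivity (limn (fun n => \int[P]_t ((h n t)%:E * (w t)%:E))).
  by congr (limn _); apply/funext => n; rewrite integralT_nnsfun sintegral_tilt.
rewrite -monotone_convergence//; last 3 first.
- by move=> n; apply: emeasurable_funM; apply/measurable_EFinP.
- by move=> n t _; rewrite -EFinM lee_fin mulr_ge0.
- by move=> t _ m n mn; rewrite lee_wpmul2r ?lee_fin//; exact: nd_h.
by apply: eq_integral => t _; apply/cvg_lim => //; exact: cvgeZr.
Qed.

End tilted_probability.

(** The product is a polynomial in [x] with an interior maximum at 0, so its derivative vanishes
    there; this derivative is the sum times the positive product of the [a i]. *)
Lemma sum_logderiv_at_max (R : realType) (n : nat) (a b : 'I_n -> R) (e : R) :
    (0 < e)%R -> (forall i, 0 < a i)%R ->
    (forall x, `|x| < e ->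
      \prod_(i < n) (a i + x * b i) <= \prod_(i < n) a i)%R ->
  (\sum_(i < n) b i / a i = 0)%R.
Proof.
move=> e0 a0 amax.
pose p : {poly R} := (\prod_(i < n) ((a i)%:P + 'X * (b i)%:P))%R.
have pE x : p.[x]%R = (\prod_(i < n) (a i + x * b i))%R.
  by rewrite horner_prod; apply: eq_bigr => i _; rewrite !hornerE.
have p0 : p.[0]%R = (\prod_(i < n) a i)%R.
  by rewrite pE; apply: eq_bigr => i _; rewrite mul0r addr0.
(* Logarithmic derivative of a product, by induction on the list of indices; [a i != 0] lets [field]
   clear the denominator. *)
have dp : (p^`().[0] = (\prod_(i < n) a i) * \sum_(i < n) b i / a i)%R.
  rewrite /p; elim: (index_enum _) => [|i s ih].
    by rewrite !big_nil derivC horner0 mulr0.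
  rewrite !big_cons derivM hornerD !hornerM ih derivD derivC derivM derivX derivC.
  rewrite !hornerE horner_prod (eq_bigr a); last by move=> j _; rewrite !hornerE.
  have ai0 : (a i != 0)%R by rewrite gt_eqF.
  by rewrite /=; field.
have dmax : is_derive (0%R : R) 1%R (horner p) 0%R.
  apply: (@derive1_at_max _ _ (- e) e).
  - by rewrite ge0_cp// ltW.
  - by move=> t _; exact: derivable_horner.
  - by rewrite in_itv/= oppr_lt0 e0.
  - by move=> t /[!in_itv]/= te; rewrite p0 pE; apply: amax; rewrite ltr_norml.
have : (p^`().[0] = 0)%R by rewrite derivE derive1E; exact: derive_val.
move/eqP; rewrite dp mulf_eq0 => /orP[|/eqP//].
by rewrite gt_eqF// prodr_gt0.
Qed.

(** Domination by [M * g]. It serves below with [g = 1] for [eta] itself, and with [g = f (Y i)] for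
    the numerators of the posterior expectations. *)
Lemma bounded_integrableMl d (T : measurableType d) (R : realType)
    (mu : {measure set T -> \bar R}) (D : set T) (b g : T -> R) (M : R) :
    measurable D -> measurable_fun D b -> (forall t, D t -> `|b t| <= M)%R ->
    mu.-integrable D (EFin \o g) ->
  mu.-integrable D (fun t => (b t * g t)%:E).
Proof.
move=> mD mb bM ig; have /measurable_EFinP mg := measurable_int _ ig.
apply: (@le_integrable _ _ _ mu D mD _ (fun t => M%:E * (EFin \o g) t)).
- by apply/measurable_EFinP; exact: measurable_funM.
- move=> t Dt /=; rewrite lee_fin !normrM ler_wpM2r//.
  by rewrite (le_trans (bM t Dt))// ler_norm.
- exact: integrableZl.
Qed.

(** A zero factor would annihilate the product, even against [+oo]. Hence the other factors have a
    positive product, and an infinite factor would make the whole product infinite. *)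
Lemma prode_gt0_lty (R : realType) (I : finType) (x : I -> \bar R) :
    (forall i, 0 <= x i) -> 0 < \prod_i x i -> \prod_i x i < +oo ->
  forall i, (0 < x i) && (x i < +oo).
Proof.
move=> x0 p0 py i; move: p0 py; rewrite (bigD1 i)//= => p0 py.
have q0 : 0 <= \prod_(j | j != i) x j by exact: prode_ge0.
have xi0 : 0 < x i.
  rewrite lt_neqAle x0 andbT eq_sym; apply/eqP => xi0.
  by move: p0; rewrite xi0 mul0e ltxx.
rewrite xi0 /= ltey; apply/eqP => xiy.
have qi0 : 0 < \prod_(j | j != i) x j.
  rewrite lt_neqAle q0 andbT eq_sym; apply/eqP => qi0.
  by move: p0; rewrite qi0 mule0 ltxx.
by move: py; rewrite xiy gt0_mulye// ltxx.
Qed.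

Theorem theorem2 (R : realType)
    (dT : measure_display) (T : measurableType dT)
    (dO : measure_display) (Omega : measurableType dO)
    (mu : {measure set T -> \bar R})
    (f : T -> Omega -> R)
    (f_density : density_family mu f)
    (f_meas : forall y : T, measurable_fun setT (f y))
    (n : nat) (n_gt0 : (0 < n)%N)
    (Y : 'I_n -> T)
    (Ghat : probability Omega R)
    (Ghat_GMLE : is_GMLE f Y Ghat)
    (eta : Omega -> R)
    (eta_meas : measurable_fun setT eta)
    (eta_bounded : bounded_fun eta) :
  'E_Ghat[eta] =
    (n%:R^-1)%:E * \sum_(i < n) posterior_expectation f Ghat eta (Y i).
Proof.
have [like_gt0 like_lty like_max] := Ghat_GMLE.
have f_ge0 y t : (0 <= f y t)%R by have [_ /(_ y)] := f_density t.
have [M M_gt0 eta_le] : exists2 M : R, (0 < M)%R & forall t, (`|eta t| <= M)%R.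
  have /pinfty_ex_gt0[M M0 hM] := eta_bounded.
  by exists M => // t; exact: hM.
have eta_int : Ghat.-integrable setT (EFin \o eta).
  apply: (@eq_integrable _ _ _ _ _ measurableT (fun t => (eta t * cst 1%R t)%:E)).
    by move=> t _; rewrite /= mulr1.
  apply: (bounded_integrableMl (M := M)) => //.
  exact: finite_measure_integrable_cst.
pose m := fine 'E_Ghat[eta].
have mE : 'E_Ghat[eta] = m%:E.
  by rewrite fineK// unlock; exact: integrable_fin_num.
have mix_bounds i : (0 < mixture_density f Ghat (Y i)) &&
    (mixture_density f Ghat (Y i) < +oo).
  apply: (prode_gt0_lty (x := fun i => mixture_density f Ghat (Y i))) => // j.
  by apply: integral_ge0 => t _; rewrite lee_fin.
(* By [mix_bounds] nothing is lost in passing to real numbers here. *)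
pose A i := fine (mixture_density f Ghat (Y i)).
have AE i : mixture_density f Ghat (Y i) = (A i)%:E.
  have /andP[? ?] := mix_bounds i.
  by rewrite fineK// ge0_fin_numE// ltW.
have A_gt0 i : (0 < A i)%R by rewrite -lte_fin -AE; case/andP: (mix_bounds i).
have f_int i : Ghat.-integrable setT (EFin \o f (Y i)).
  apply/integrableP; split; first exact/measurable_EFinP.
  under eq_integral => t _ do rewrite /= ger0_norm//.
  by case/andP: (mix_bounds i).
have ef_int i : Ghat.-integrable setT (fun t => (eta t * f (Y i) t)%:E).
  exact: (bounded_integrableMl (M := M)).
pose B i := fine (\int[Ghat]_t (eta t * f (Y i) t)%:E).
have BE i : \int[Ghat]_t (eta t * f (Y i) t)%:E = (B i)%:E.
  by rewrite fineK//; exact: integrable_fin_num.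
(* The mean inherits the bound on [eta] because [Ghat] has mass 1; this yields
   [|eta t - m| <= 2M]. *)
have m_le : (`|m| <= M)%R.
  rewrite -lee_fin -[M%:E]mule1 -(@probability_setT _ _ _ Ghat).
  have meta : measurable_fun setT (EFin \o eta) by exact/measurable_EFinP.
  have -> : `|m|%:E = `|\int[Ghat]_t (EFin \o eta) t|.
    by rewrite -abse_EFin -mE unlock.
  apply: le_trans (le_abse_integral _ measurableT meta) _.
  apply: integral_le_bound => //; first by rewrite lee_fin ltW.
  by apply: aeW => t _; rewrite /= lee_fin.
have lik0 : likelihood f Y Ghat = (\prod_i A i)%:E.
  by rewrite -prodEFin; apply: eq_bigr => i _; exact: AE.
(* The radius [1 / (2M)] ensures [|e * (eta t - m)| <= 1], hence a nonnegative weight [w]. *)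
have tilt_lik e : (`|e| < (M *+ 2)^-1 ->
    \prod_i (A i + e * (B i - m * A i)) <= \prod_i A i)%R.
  move=> he; pose w t := (1 + e * (eta t - m))%R.
  have w_ge0 t : (0 <= w t)%R.
    rewrite /w -lerBlDl sub0r lerNl; apply: ler_normlW; rewrite normrN normrM.
    have d2 : (`|eta t - m| <= M *+ 2)%R.
      by rewrite (le_trans (ler_normB _ _))// mulr2n lerD.
    rewrite (le_trans (ler_pM _ _ (ltW he) d2))//.
    by rewrite mulVf// gt_eqF// mulrn_wgt0.
  have w_meas : measurable_fun setT w.
    apply: measurable_funD => //; apply: measurable_funM => //.
    exact: measurable_funB.
  (* Stated for general [g] because it is used twice: [g = 1] gives the total mass of the tilt,
     [g = f (Y i)] its mixture density at [Y i]. *)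
  have w_int (g : Omega -> R) (a b : R) :
      Ghat.-integrable setT (EFin \o g) ->
      Ghat.-integrable setT (fun t => (eta t * g t)%:E) ->
      \int[Ghat]_t (g t)%:E = a%:E ->
      \int[Ghat]_t (eta t * g t)%:E = b%:E ->
      \int[Ghat]_t (g t * w t)%:E = (a + e * (b - m * a))%:E.
    move=> ig ieg ga gb.
    under eq_integral => t _.
      rewrite (_ : (g t * w t)%:E =
        (1 - e * m)%:E * (g t)%:E + e%:E * (eta t * g t)%:E); last first.
      by rewrite -!EFinM -EFinD /w; congr EFin; ring.
      over.
    rewrite integralD//; [|exact: integrableZl..].
    by rewrite !integralZl// ga gb -!EFinM -EFinD; congr EFin; ring.
  have w_int1 : \int[Ghat]_t (w t)%:E = 1.
    (* Centring [eta] at its mean makes the first-order term [e * (m - m * 1)] vanish, so the mass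
       stays 1. *)
    have := w_int (cst 1%R) 1%R m.
    rewrite mulr1 subrr mulr0 addr0 => <-.
    - by apply: eq_integral => t _; rewrite /= mul1r.
    - exact: finite_measure_integrable_cst.
    - by apply: eq_integrable eta_int => // t _; rewrite /= mulr1.
    - by rewrite [LHS](integral_cst _ measurableT 1) mul1e; exact: probability_setT.
    - by under eq_integral do rewrite mulr1; rewrite -mE unlock.
  (* Maximality is tested against the tilted law, whose factor at [Y i] is
     [A i + e * (B i - m * A i)]. *)
  have := like_max (tilt_of w_ge0 w_meas w_int1).
  rewrite lik0 -lee_fin; congr (_ <= _); rewrite -prodEFin.
  apply: eq_bigr => i _; rewrite /mixture_density ge0_integral_tilt//.
  - under eq_integral do rewrite -EFinM.
    exact: w_int (f_int i) (ef_int i) (AE i) (BE i).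
  - exact/measurable_EFinP.
  - by move=> t; rewrite lee_fin.
have sum0 : (\sum_i (B i - m * A i) / A i = 0)%R.
  by apply: sum_logderiv_at_max A_gt0 tilt_lik; rewrite invr_gt0 mulrn_wgt0.
have post i : posterior_expectation f Ghat eta (Y i) = (B i / A i)%:E.
  by rewrite /posterior_expectation AE BE inver gt_eqF// -EFinM.
rewrite mE (eq_bigr _ (fun i _ => post i)) sumEFin -EFinM; congr EFin.
(* Splitting off the vanishing sum [sum0] leaves [n] copies of [m], and [n > 0] allows division by
   [n]. *)
have -> : (\sum_i B i / A i = \sum_i ((B i - m * A i) / A i + m))%R.
  by apply: eq_bigr => i _; rewrite mulrBl mulfK ?subrK// gt_eqF.
rewrite big_split/= sum0 add0r sumr_const card_ord -[(m *+ n)%R]mulr_natl mulrA.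
by rewrite mulVf ?mul1r// pnatr_eq0 -lt0n.
Qed.
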